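(* The following recurrence relations hold: $$TB(z)=z\,B(z),\qquad \bar A(z^{-1})\,T=z\,\bar A(z^{-1}),$$ $$\mathcal T\,\bar{\mathcal A}(z^{-1})=z\,\bar{\mathcal A}(z^{-1}),\qquad \mathcal B(z)\,\mathcal T=z\,\mathcal B(z).$$
   Context: Let $p,q\in\mathbb N$ and let $\mu$ be a $q\times p$ matrix of complex Borel measures with infinite support on the unit circle $\mathbb T=\{|z|=1\}$. Rows and columns of semi-infinite matrices are indexed from $0$. For $r\in\mathbb N$, $Z_{[r]}(z)$ is the $\infty\times r$ matrix obtained by stacking the $r\times r$ blocks $I_r, z^{-1}I_r, zI_r, z^{-2}I_r, z^2I_r,\dots$ (block number $2N$ is $z^NI_r$, block number $2N+1$ is $z^{-N-1}I_r$). The left and right moment matrices are $$M=\oint_{\mathbb T}Z_{[q]}(z)\,\mathrm d\mu(z)\,Z_{[p]}^\top(z^{-1}),\qquad \mathcal M=\oint_{\mathbb T}Z_{[q]}(z^{-1})\,\mathrm d\mu(z)\,Z_{[p]}^\top(z).$$ It is assumed that they have Gauss--Borel factorizations $M=L^{-1}\bar U^{-1}$ and $\mathcal M=\bar{\mathcal L}^{-1}\mathcal U^{-1}$, with $L,\mathcal L$ lower triangular and $U,\mathcal U$ upper triangular semi-infinite matrices with nonzero diagonal entries (bar = entrywise complex conjugation). Put $$B(z)=LZ_{[q]}(z),\quad A(z)=Z_{[p]}^\top(z)U,\quad \mathcal A(z)=\mathcal LZ_{[q]}(z),\quad \mathcal B(z)=Z_{[p]}^\top(z)\,\mathcal U .$$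 For a Laurent polynomial with matrix coefficients $P(z)=\sum P_kz^k$, $\bar P(z)=\sum\bar P_kz^k$. $\Upsilon_{[r]}$ is the semi-infinite permutation matrix whose $r\times r$ blocks (block indices from $0$) are $I_r$ at block positions $(2k,2k+2)$, $k\ge0$, at $(1,0)$, and at $(2k+3,2k+1)$, $k\ge0$, and zero elsewhere. One has $\Upsilon_{[q]}M=M\Upsilon_{[p]}$ and $\Upsilon_{[q]}^\top\mathcal M=\mathcal M\Upsilon_{[p]}^\top$, and the matrices $T,\mathcal T$ are defined by $$T=L\Upsilon_{[q]}L^{-1}=\bar U^{-1}\Upsilon_{[p]}\bar U,\qquad \mathcal T=\bar{\mathcal L}\Upsilon_{[q]}^\top\bar{\mathcal L}^{-1}=\mathcal U^{-1}\Upsilon_{[p]}^\top\mathcal U.$$ *)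

(* Defs.v *)
From HB Require Import structures.
From mathcomp Require Import all_boot all_order all_algebra.
From mathcomp Require Import all_classical all_reals all_analysis.
From mathcomp Require Import complex.

Set Implicit Arguments.
Unset Strict Implicit.
Unset Printing Implicit Defensive.

Import Order.TTheory GRing.Theory Num.Theory.
Import numFieldNormedType.Exports.

Local Open Scope classical_set_scope.
Local Open Scope ring_scope.

(* Usual topology of the complex plane, given by the norm `|z|. *)
HB.instance Definition _ (R : realType) := NormedModule.copy R[i] (R[i])^o.

Definition circle (R : realType) : set R[i] := [set z | `|z| = 1].
Arguments circle : clear implicits.

Lemma circle1 (R : realType) : (1 : R[i]) \in circle R.
Proof. by rewrite inE /circle /= normr1. Qed.

HB.instance Definition _ (R : realType) :=
  isPointed.Build (circle R) (exist _ 1 (circle1 R)).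

(* The circle, with the Borel sigma-algebra of its subspace topology. *)
Definition borelCircle (R : realType) := g_sigma_algebraType (@open (circle R)).
Arguments borelCircle : clear implicits.

Definition circle_val (R : realType) (z : borelCircle R) : R[i] :=
  \val (z : circle R).

(* A charge is sigma-additive and takes finite values, so that a charge with
   values in \bar R[i] is a complex measure. *)
Definition complexMeasure (R : realType) :=
  {charge set (borelCircle R) -> \bar R[i]}.
Arguments complexMeasure : clear implicits.

Section part.
Context d (T : measurableType d) (R : realType).
Variable h : R[i] -> R.
Hypothesis hB : {morph h : x y / x - y}.
Hypothesis h_le : forall z, (`|h z|)%:C%C <= `|z|.
Variable nu : {charge set T -> \bar R[i]}.

Let part (A : set T) : \bar R := (h (fine (nu A)))%:E.

Let h0 : h 0 = 0. Proof. by rewrite -(subrr 0) hB subrr. Qed.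

Let hD : {morph h : x y / x + y}.
Proof.
move=> x y; rewrite -[y in LHS]opprK hB.
by rewrite -[- y]sub0r hB h0 sub0r opprK.
Qed.

Lemma part0 : part set0 = 0%E.
Proof. by rewrite /part charge0 /= h0. Qed.

Lemma part_fin A : measurable A -> part A \is a fin_num.
Proof. by []. Qed.

Let h_cvg (u : nat -> R[i]) (l : R[i]) : u @ \oo --> l -> h \o u @ \oo --> h l.
Proof.
move=> /cvgrPdist_lt ul; apply/cvgrPdist_lt => e e0.
have /ul : 0 < e%:C%C :> R[i] by rewrite ltcR.
by apply: filterS => n /= ?; rewrite -hB -ltcR (le_lt_trans (h_le _)).
Qed.

Lemma part_sigma_additive : semi_sigma_additive part.
Proof.
move=> F mF tF mUF.
have nuF k : nu (F k) = (fine (nu (F k)))%:E by rewrite fineK ?fin_num_measure.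
have /fine_cvg/h_cvg cvgF :
    (fun n => \sum_(0 <= i < n) nu (F i))%E @ \oo -->
    (fine (nu (\bigcup_n F n)))%:E.
  by rewrite fineK ?fin_num_measure//; exact: charge_semi_sigma_additive.
rewrite (_ : (fun n => _) =
    EFin \o (h \o (fine \o (fun n => \sum_(0 <= i < n) nu (F i))%E))).
  by apply: cvg_EFin cvgF; exact: nearW.
apply/funext => n /=; rewrite sumEFin; congr EFin.
under [in RHS]eq_bigr do rewrite nuF.
by rewrite sumEFin /= (big_morph h hD h0).
Qed.

End part.

Lemma ReB (R : realType) : {morph (@complex.Re R) : x y / x - y}.
Proof. by case=> ? ? [? ?]. Qed.

Lemma ImB (R : realType) : {morph (@complex.Im R) : x y / x - y}.
Proof. by case=> ? ? [? ?]. Qed.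

Lemma normc_ge_Im (R : realType) (z : R[i]) : (`|complex.Im z|)%:C%C <= `|z|.
Proof.
by case: z => a b; rewrite normc_def lecR -sqrtr_sqr ler_wsqrtr// lerDr sqr_ge0.
Qed.

Section complex_measure.
Context d (T : measurableType d) (R : realType).
Implicit Types nu : {charge set T -> \bar R[i]}.

Definition re_part nu (A : set T) : \bar R := (complex.Re (fine (nu A)))%:E.

HB.instance Definition _ nu := isCharge.Build d T R (re_part nu)
  (part0 (@ReB R) nu) (@part_fin _ _ _ _ nu)
  (part_sigma_additive (@ReB R) (@normc_ge_Re R) (nu := nu)).

Definition im_part nu (A : set T) : \bar R := (complex.Im (fine (nu A)))%:E.

HB.instance Definition _ nu := isCharge.Build d T R (im_part nu)
  (part0 (@ImB R) nu) (@part_fin _ _ _ _ nu)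
  (part_sigma_additive (@ImB R) (@normc_ge_Im R) (nu := nu)).

Definition total_variation nu (A : set T) : \bar R :=
  ereal_sup [set (\sum_(0 <= k <oo) (Normc.normc (fine (nu (F k))))%:E)%E |
    F in [set F : (set T)^nat | [/\ forall k, measurable (F k),
                                    trivIset [set: nat] F &
                                    \bigcup_k F k = A]]].

End complex_measure.

Section integral.
Context d (T : measurableType d) (R : realType).

Section hahn.
Variable nu : {charge set T -> \bar R}.

Let hahn_ex : {P | exists N, hahn_decomposition nu P N} :=
  cid (Hahn_decomposition nu).

Definition hahn_pos : set T := sval hahn_ex.

Definition hahn_neg : set T := sval (cid (svalP hahn_ex)).

Definition hahnP : hahn_decomposition nu hahn_pos hahn_neg :=
  svalP (cid (svalP hahn_ex)).

(* Independent of the chosen Hahn decomposition. *)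
Definition charge_integral (f : T -> R) : R :=
  \int[jordan_pos hahnP]_x f x - \int[jordan_neg hahnP]_x f x.

End hahn.

Definition complex_integral (nu : {charge set T -> \bar R[i]})
    (f : T -> R[i]) : R[i] :=
  ((charge_integral (re_part nu) (fun x => complex.Re (f x)) -
    charge_integral (im_part nu) (fun x => complex.Im (f x))) +i*
   (charge_integral (re_part nu) (fun x => complex.Im (f x)) +
    charge_integral (im_part nu) (fun x => complex.Re (f x))))%C.

End integral.

Definition measure_support (R : realType) (mu : complexMeasure R) :
    set (circle R) :=
  [set z | forall V : set (circle R), open V -> V z ->
    (0 < total_variation mu (V : set (borelCircle R)))%E].

(* Matrices, possibly with infinitely many rows or columns. The sum in the
   product is over the finitely many nonzero terms; it is 0 by convention if
   infinitely many terms are nonzero. *)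
Section matrices.
Context {C : numClosedFieldType}.

Definition smul {I J : Type} {K : choiceType} (A : I -> K -> C)
    (B : K -> J -> C) : I -> J -> C :=
  fun i j => \sum_(k \in [set: K]) A i k * B k j.

Definition sscale {I J : Type} (c : C) (A : I -> J -> C) : I -> J -> C :=
  fun i j => c * A i j.

Definition strans {I J : Type} (A : I -> J -> C) : J -> I -> C :=
  fun j i => A i j.

Definition sconj {I J : Type} (A : I -> J -> C) : I -> J -> C :=
  fun i j => (A i j)^*.

Definition sid : nat -> nat -> C := fun n m => (n == m)%:R.

(* For a triangular A with nonzero diagonal entries, the two-sided inverse
   exists and is unique. *)
Definition sinv (A : nat -> nat -> C) : nat -> nat -> C :=
  xget sid [set X | smul A X = sid /\ smul X A = sid].

Definition lower_triangular (A : nat -> nat -> C) :=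
  forall n m, (n < m)%N -> A n m = 0.

Definition upper_triangular (A : nat -> nat -> C) :=
  forall n m, (m < n)%N -> A n m = 0.

Definition nonzero_diagonal (A : nat -> nat -> C) := forall n, A n n != 0.

End matrices.

Notation "A '**' B" := (smul A B) (at level 40, left associativity).

(* Laurent polynomials with matrix coefficients: P k is the coefficient of
   z ^ k, and each entry is nonzero for finitely many k only. *)
Section laurent.
Context {C : numClosedFieldType}.

Definition laurent (I J : Type) := int -> I -> J -> C.

Definition leval {I J : Type} (P : laurent I J) (z : C) : I -> J -> C :=
  fun i j => \sum_(k \in [set: int]) P k i j * z ^ k.

Definition ltrans {I J : Type} (P : laurent I J) : laurent J I :=
  fun k => strans (P k).

Definition lconj {I J : Type} (P : laurent I J) : laurent I J :=
  fun k => sconj (P k).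

Definition lmull {I J : Type} {K : choiceType} (A : I -> K -> C)
    (P : laurent K J) : laurent I J :=
  fun k => A ** P k.

Definition lmulr {I J : Type} {K : choiceType} (P : laurent I K)
    (A : K -> J -> C) : laurent I J :=
  fun k => P k ** A.

(* Block number 2N of Z_[r] is z^N I_r, block number 2N+1 is z^(-N-1) I_r. *)
Definition Zexp (b : nat) : int :=
  if odd b then - (b./2.+1)%:Z else (b./2)%:Z.

Definition Zmx (r : nat) : laurent nat 'I_r :=
  fun k n j => ((k == Zexp (n %/ r)) && (n %% r == j)%N)%:R.

Definition Upsilon_block (a b : nat) : bool :=
  [|| ~~ odd a && (b == a.+2), (a == 1)%N && (b == 0)%N |
      odd b && (a == b.+2)].

Definition Upsilon (r : nat) : nat -> nat -> C :=
  fun n m => (Upsilon_block (n %/ r) (m %/ r) && (n %% r == m %% r)%N)%:R.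

End laurent.

Arguments Zmx {C} r k n j.

Section moments.
Context {R : realType} {p q : nat}.
Variable mu : 'M[complexMeasure R]_(q, p).

(* Integral of F(z) dmu(z) G(z). *)
Definition oint_mx (F : R[i] -> nat -> 'I_q -> R[i])
    (G : R[i] -> 'I_p -> nat -> R[i]) : nat -> nat -> R[i] :=
  fun n m => \sum_(i < q) \sum_(j < p)
    complex_integral (mu i j)
      (fun z => F (circle_val z) n i * G (circle_val z) j m).

Definition left_moment : nat -> nat -> R[i] :=
  oint_mx (fun z => leval (Zmx q) z) (fun z => leval (ltrans (Zmx p)) z^-1).

Definition right_moment : nat -> nat -> R[i] :=
  oint_mx (fun z => leval (Zmx q) z^-1) (fun z => leval (ltrans (Zmx p)) z).

End moments.

(* Main.v *)
(* Multiplication by [z] acts on the blocks of [Z_[r](z)] as [Upsilon r], whose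
   transpose multiplies by [z^-1]; hence [Upsilon q M = M Upsilon p] holds under
   the integral sign. Inserting the factorization of [M] into this identity
   gives [T = V^-1 (Upsilon p) V] with [V] the conjugate of [U], and the
   recurrences follow by conjugating the action of [Upsilon]. Products of
   infinite matrices are reassociated only when two of the factors have finitely
   supported rows (or columns), which makes all the sums finite. *)
Require Import Defs.
From HB Require Import structures.
From mathcomp Require Import all_boot all_order all_algebra.
From mathcomp Require Import all_classical all_reals all_analysis.
From mathcomp Require Import complex zify.

Set Implicit Arguments.
Unset Strict Implicit.
Unset Printing Implicit Defensive.

Import Order.TTheory GRing.Theory Num.Theory.
Local Open Scope classical_set_scope.
Local Open Scope ring_scope.

(** * Semi-infinite matrices with finitely supported rows or columns *)

Section finite_rows.
Context {C : numClosedFieldType}.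
Implicit Types I J : Type.

Definition row_finite I (A : I -> nat -> C) :=
  forall i, exists N, forall k, (N <= k)%N -> A i k = 0.

Definition column_finite J (A : nat -> J -> C) := row_finite (strans A).

Lemma smulE N I J (A : I -> nat -> C) (B : nat -> J -> C) i j :
  (forall k, (N <= k)%N -> A i k * B k j = 0) ->
  (A ** B) i j = \sum_(k < N) A i k * B k j.
Proof.
move=> h; rewrite /smul [RHS](fsbig_ord _ _ (fun k => A i k * B k j)).
by apply/esym/fsbig_widen => // k [_ /= /negP]; rewrite -leqNgt => /h.
Qed.

Lemma strans_smul I J (A : I -> nat -> C) (B : nat -> J -> C) :
  strans (A ** B) = strans B ** strans A.
Proof.
apply/funext => j; apply/funext => i; apply: eq_fsbigr => k _.
by rewrite mulrC.
Qed.

(** Both sides reduce to one finite double sum over [k < N] and [l < M]. Bounding the product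
    [B k l * D l j] rather than one factor covers finite rows of [B] and finite columns of [D]
    alike. *)
Lemma smulA_entry N M I J (A : I -> nat -> C) (B : nat -> nat -> C)
    (D : nat -> J -> C) i j :
  (forall k, (N <= k)%N -> A i k = 0) ->
  (forall k l, (k < N)%N -> (M <= l)%N -> B k l * D l j = 0) ->
  (A ** (B ** D)) i j = (A ** B ** D) i j.
Proof.
move=> hA hBD.
have AB l : (A ** B) i l = \sum_(k < N) A i k * B k l.
  by apply: smulE => k /hA->; rewrite mul0r.
rewrite (@smulE N) => [|k /hA->]; last by rewrite mul0r.
rewrite (@smulE M) => [|l Ml]; last first.
  by rewrite AB mulr_suml big1// => k _; rewrite -mulrA hBD ?mulr0.
under [RHS]eq_bigr do rewrite AB mulr_suml.
rewrite exchange_big; apply: eq_bigr => k _.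
rewrite (@smulE M) => [|l]; last exact: hBD.
by rewrite mulr_sumr; apply: eq_bigr => l _; rewrite mulrA.
Qed.

Lemma row_finite_bound (B : nat -> nat -> C) N : row_finite B ->
  exists M, forall k l, (k < N)%N -> (M <= l)%N -> B k l = 0.
Proof.
move=> hB; elim: N => [|N [M hM]]; first by exists 0%N.
have [M' hM'] := hB N; exists (maxn M M') => k l.
rewrite ltnS leq_eqVlt geq_max => /orP[/eqP->|kN] /andP[Ml M'l].
  exact: hM'.
exact: hM.
Qed.

Lemma smulA_row I J (A : I -> nat -> C) (B : nat -> nat -> C)
    (D : nat -> J -> C) : row_finite A -> row_finite B ->
  A ** (B ** D) = A ** B ** D.
Proof.
move=> hA hB; apply/funext => i; apply/funext => j.
have [N hN] := hA i; have [M hM] := row_finite_bound N hB.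
by apply: (smulA_entry (M := M) hN) => k l kN Ml; rewrite hM ?mul0r.
Qed.

Lemma smulA_row_column I J (A : I -> nat -> C) (B : nat -> nat -> C)
    (D : nat -> J -> C) : row_finite A -> column_finite D ->
  A ** (B ** D) = A ** B ** D.
Proof.
move=> hA hD; apply/funext => i; apply/funext => j.
have [N hN] := hA i; have [M hM] := hD j.
by apply: (smulA_entry (M := M) hN) => k l _ /hM; rewrite /strans => ->; rewrite mulr0.
Qed.

Lemma smulA_column I J (A : I -> nat -> C) (B : nat -> nat -> C)
    (D : nat -> J -> C) : column_finite B -> column_finite D ->
  A ** (B ** D) = A ** B ** D.
Proof.
(* Transposition reverses products and exchanges row and column finiteness. *)
move=> hB hD; have E : strans (A ** (B ** D)) = strans (A ** B ** D).
  by rewrite !strans_smul smulA_row.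
exact: (congr1 strans E).
Qed.

Lemma row_finite_smul I (A : I -> nat -> C) (B : nat -> nat -> C) :
  row_finite A -> row_finite B -> row_finite (A ** B).
Proof.
move=> hA hB i; have [N hN] := hA i; have [M hM] := row_finite_bound N hB.
exists M => l Ml; rewrite (@smulE N) => [|k /hN->]; last by rewrite mul0r.
by rewrite big1// => k _; rewrite hM ?mulr0.
Qed.

Lemma column_finite_smul J (A : nat -> nat -> C) (B : nat -> J -> C) :
  column_finite A -> column_finite B -> column_finite (A ** B).
Proof.
by move=> hA hB; rewrite /column_finite strans_smul; exact: row_finite_smul.
Qed.

Lemma smul_delta I J (f : I -> nat) (A : I -> nat -> C) (B : nat -> J -> C) i j :
  (forall k, A i k = (k == f i)%:R) -> (A ** B) i j = B (f i) j.
Proof.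
move=> hA; rewrite (@smulE (f i).+1) => [|k]; last first.
  by rewrite hA => /gtn_eqF->; rewrite mul0r.
rewrite big_ord_recr /= hA eqxx mul1r big1 ?add0r// => k _.
by rewrite hA ltn_eqF ?mul0r.
Qed.

Lemma smul1m J (B : nat -> J -> C) : sid ** B = B.
Proof.
apply/funext => i; apply/funext => j.
by apply: (smul_delta (f := id)) => k; rewrite /sid eq_sym.
Qed.

Lemma strans_sid : strans (@sid C) = sid.
Proof. by apply/funext => i; apply/funext => j; rewrite /strans /sid eq_sym. Qed.

Lemma smulm1 I (A : I -> nat -> C) : A ** sid = A.
Proof.
have E : strans (A ** sid) = strans A.
  by rewrite strans_smul strans_sid smul1m.
exact: (congr1 strans E).
Qed.

Lemma sconj_smul I J (A : I -> nat -> C) (B : nat -> J -> C) :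
  row_finite A -> sconj (A ** B) = sconj A ** sconj B.
Proof.
move=> hA; apply/funext => i; apply/funext => j; have [N hN] := hA i.
rewrite (@smulE N) => [|k /hN]; last by rewrite /sconj => ->; rewrite rmorph0 mul0r.
rewrite /sconj (@smulE N) => [|k /hN->]; last by rewrite mul0r.
by rewrite rmorph_sum; apply: eq_bigr => k _; rewrite rmorphM.
Qed.

(** * Triangular matrices, their inverses, and the Gauss-Borel intertwining *)

Lemma row_finite_lower (A : nat -> nat -> C) :
  lower_triangular A -> row_finite A.
Proof. by move=> hA n; exists n.+1 => k; exact: hA. Qed.

Lemma column_finite_upper (A : nat -> nat -> C) :
  upper_triangular A -> column_finite A.
Proof. by move=> hA n; exists n.+1 => k; exact: hA. Qed.

Lemma lower_sconj (A : nat -> nat -> C) :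
  lower_triangular A -> lower_triangular (sconj A).
Proof. by move=> hA n m /hA; rewrite /sconj => ->; rewrite rmorph0. Qed.

Lemma upper_sconj (A : nat -> nat -> C) :
  upper_triangular A -> upper_triangular (sconj A).
Proof. by move=> hA n m /hA; rewrite /sconj => ->; rewrite rmorph0. Qed.

Lemma nonzero_diagonal_sconj (A : nat -> nat -> C) :
  nonzero_diagonal A -> nonzero_diagonal (sconj A).
Proof. by move=> hA n; rewrite fmorph_eq0. Qed.

(** Forward substitution: row [n] of the equation [A ** Y = sid] is solved for row [n] of [Y], and
    induction shows [Y ** A = sid]. The nonzero diagonal is recorded so that the result applies to
    [Y] in turn. *)
Lemma lower_left_inverse (A : nat -> nat -> C) :
    lower_triangular A -> nonzero_diagonal A ->
  exists Y, [/\ lower_triangular Y, nonzero_diagonal Y & Y ** A = sid].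
Proof.
move=> hA hA0.
(* The last clause says that [y] times [A] is the [n]-th unit vector; every truncation [N > n] is
   allowed so that different rows can be summed over a common range. *)
pose row n (y : nat -> C) := [/\ forall m, (n < m)%N -> y m = 0, y n != 0 &
  forall N m, (n < N)%N -> \sum_(l < N) y l * A l m = (n == m)%:R].
have rows n : exists Y, forall k, (k < n)%N -> row k (Y k).
  elim: n => [|n [Y hY]]; first by exists A.
  pose y m := ((n == m)%:R - \sum_(k < n) A n k * Y k m) / A n n.
  exists (fun k => if k == n then y else Y k) => k.
  rewrite ltnS leq_eqVlt; case: eqVneq => /= [->{k} _|_ /hY//]; split.
  - move=> m nm; rewrite /y ltn_eqF// big1 ?subrr ?mul0r// => k _.
    have [Yk _ _] := hY k (ltn_ord k).
    by rewrite Yk ?mulr0//; apply: ltn_trans nm.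
  - rewrite /y eqxx big1 ?subr0 ?mul1r ?invr_eq0// => k _.
    by have [Yk _ _] := hY k (ltn_ord k); rewrite Yk ?mulr0.
  move=> N m nN.
  (* Each earlier row times [A] is a unit vector, so [y] times [A] is row [n] of [A] with the
     entries left of the diagonal removed, divided by [A n n]. *)
  have -> : \sum_(l < N) y l * A l m =
      (A n m - \sum_(k < n) A n k * (nat_of_ord k == m)%:R) / A n n.
    rewrite (eq_bigr (fun l : 'I_N => (n == l)%:R * A l m / A n n -
      (\sum_(k < n) A n k * Y k l * A l m) / A n n)) => [|l _]; last first.
      by rewrite /y mulrAC mulrBl mulr_suml mulrBl.
    rewrite sumrB mulrBl -!mulr_suml; congr (_ - _).
      rewrite (bigD1 (Ordinal nN))//= eqxx mul1r big1 ?addr0// => l.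
      by rewrite -val_eqE/= eq_sym => /negPf->; rewrite mul0r.
    rewrite exchange_big; congr (_ / _); apply: eq_bigr => k _.
    have [_ _ Yk] := hY k (ltn_ord k).
    rewrite -(Yk N m (ltn_trans (ltn_ord k) nN)).
    by rewrite mulr_sumr; apply: eq_bigr => l _; rewrite mulrA.
  case: (ltngtP n m) => [nm|mn|<-].
  - rewrite hA// big1 ?subrr ?mul0r// => k _.
    by rewrite ltn_eqF ?mulr0// (ltn_trans _ nm).
  - rewrite (bigD1 (Ordinal mn))//= eqxx mulr1 big1 ?addr0 ?subrr ?mul0r// => k.
    by rewrite -val_eqE/= => /negPf->; rewrite mulr0.
  - rewrite big1 ?subr0 ?divff// => k _.
    by rewrite ltn_eqF ?mulr0.
(* Prefixes obtained for different [n] need not agree: [row n] constrains a single row, so the last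
   row of each prefix can be taken. *)
have /choice[Y hY] n : exists y, row n y.
  by have [Y hY] := rows n.+1; exists (Y n); exact: hY.
exists Y; split=> [n m|n|]; [by have [+ _ _] := hY n; apply|by have [] := hY n|].
apply/funext => n; apply/funext => m; have [Yn _ YA] := hY n.
rewrite /sid -(YA n.+1 m (ltnSn n)).
by apply: smulE => k /Yn->; rewrite mul0r.
Qed.

(** If [Z] is a left inverse of [Y], then [A = Z ** Y ** A = Z], so the left inverse [Y] is
    two-sided. *)
Lemma lower_inverse (A : nat -> nat -> C) :
    lower_triangular A -> nonzero_diagonal A ->
  exists Y, [/\ lower_triangular Y, A ** Y = sid & Y ** A = sid].
Proof.
move=> hA hA0; have [Y [hY hY0 YA]] := lower_left_inverse hA hA0.
have [Z [hZ _ ZY]] := lower_left_inverse hY hY0.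
exists Y; split=> //; suff -> : A = Z by [].
rewrite -[A]smul1m -ZY -smulA_row ?YA ?smulm1//; exact: row_finite_lower.
Qed.

(** [sinv] chooses some two-sided inverse, of unknown shape; uniqueness identifies it with the
    triangular one, whence its finite rows. *)
Lemma lower_sinv (A : nat -> nat -> C) :
    lower_triangular A -> nonzero_diagonal A ->
  [/\ row_finite (sinv A), A ** sinv A = sid & sinv A ** A = sid].
Proof.
move=> hA hA0; have [Y [hY AY YA]] := lower_inverse hA hA0.
have [AX XA] : A ** sinv A = sid /\ sinv A ** A = sid.
  by apply: (@xgetPex _ sid [set X | A ** X = sid /\ X ** A = sid]); exists Y.
suff e : sinv A = Y by split=> //; rewrite e; exact: row_finite_lower.
(* Regrouping [Y ** A ** sinv A] rests on the finite rows of [Y] and [A]. *)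
rewrite -[LHS]smul1m -YA -smulA_row ?AX ?smulm1//; exact: row_finite_lower.
Qed.

(** The lower triangular [strans A] is inverted and the result transposed back. *)
Lemma upper_sinv (A : nat -> nat -> C) :
    upper_triangular A -> nonzero_diagonal A ->
  [/\ column_finite (sinv A), A ** sinv A = sid & sinv A ** A = sid].
Proof.
move=> hA hA0.
have [] := @lower_inverse (strans A); [by move=> n m /hA|by []|move=> Y].
move=> [hY AY YA].
have {}AY : strans Y ** A = sid.
  by rewrite -strans_sid -AY strans_smul.
have {}YA : A ** strans Y = sid.
  by rewrite -strans_sid -YA strans_smul.
have [AX XA] : A ** sinv A = sid /\ sinv A ** A = sid.
  by apply: (@xgetPex _ sid [set X | A ** X = sid /\ X ** A = sid]); exists (strans Y).
have Yfin : column_finite (strans Y) by exact: row_finite_lower.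
suff e : sinv A = strans Y by split=> //; rewrite e.
rewrite -[LHS]smulm1 -YA smulA_column ?XA ?smul1m//; exact: column_finite_upper.
Qed.

(** The matrix [L ** S ** sinv L] also equals [sinv V ** S' ** V]. The first form shows finite rows,
    the second finite columns. *)
Lemma gauss_borel_intertwine (L V S S' : nat -> nat -> C) :
    lower_triangular L -> nonzero_diagonal L ->
    upper_triangular V -> nonzero_diagonal V ->
    row_finite S -> column_finite S' ->
    S ** (sinv L ** sinv V) = sinv L ** sinv V ** S' ->
  column_finite (L ** S ** sinv L) /\ V ** (L ** S ** sinv L) = S' ** V.
Proof.
move=> hL hL0 hV hV0 Sfin S'fin SM.
have [iLfin LiL iLL] := lower_sinv hL hL0.
have [iVfin ViV iVV] := upper_sinv hV hV0.
have Lfin := row_finite_lower hL; have Vfin := column_finite_upper hV.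
(* Multiplying [SM] by [L] on the left cancels [sinv L]. *)
have TV : L ** S ** sinv L ** sinv V = sinv V ** S'.
  rewrite -[LHS]smulA_row//; last exact: row_finite_smul.
  rewrite -[LHS]smulA_row// SM -[X in L ** X]smulA_column//.
  by rewrite smulA_row// LiL smul1m.
have TE : L ** S ** sinv L = sinv V ** S' ** V.
  by rewrite -TV -[RHS]smulA_column// iVV smulm1.
split; first by rewrite TE; do 2?apply: column_finite_smul.
rewrite TE smulA_column//; last exact: column_finite_smul.
by congr (_ ** V); rewrite smulA_column// ViV smul1m.
Qed.

Lemma smul_sscale I J c (A : I -> nat -> C) (B : nat -> J -> C) :
  A ** sscale c B = sscale c (A ** B).
Proof.
apply/funext => i; apply/funext => j; rewrite /sscale /smul mulr_fsumr.
by apply: eq_fsbigr => k _; rewrite mulrCA.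
Qed.

(** The columns of [X] may have infinite support, so regrouping relies on the finite rows of the
    other factors; [sinv L ** L] cancels and [S] reaches its eigenvector [X]. *)
Lemma lower_recurrence J (L S : nat -> nat -> C) (X : nat -> J -> C) z :
    lower_triangular L -> nonzero_diagonal L -> row_finite S ->
    S ** X = sscale z X ->
  L ** S ** sinv L ** (L ** X) = sscale z (L ** X).
Proof.
move=> hL hL0 Sfin SX; have [iLfin _ iLL] := lower_sinv hL hL0.
have Lfin := row_finite_lower hL.
have LSfin := row_finite_smul Lfin Sfin.
rewrite smulA_row//; last exact: row_finite_smul.
by rewrite -(smulA_row L)// iLL smulm1 -smulA_row// SX smul_sscale.
Qed.

(** Here the rows of [X] may have infinite support, so regrouping relies on finite columns. The
    intertwining moves the matrix past [V], where it becomes [S'] and acts on [X]. *)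
Lemma upper_recurrence I (L V S S' : nat -> nat -> C) (X : I -> nat -> C) z :
    lower_triangular L -> nonzero_diagonal L ->
    upper_triangular V -> nonzero_diagonal V ->
    row_finite S -> column_finite S' ->
    S ** (sinv L ** sinv V) = sinv L ** sinv V ** S' ->
    X ** S' = sscale z X ->
  X ** V ** (L ** S ** sinv L) = sscale z (X ** V).
Proof.
move=> hL hL0 hV hV0 Sfin S'fin SM XS.
have [Tfin VT] := gauss_borel_intertwine hL hL0 hV hV0 Sfin S'fin SM.
have Vfin := column_finite_upper hV.
rewrite -smulA_column// VT smulA_column// XS.
apply/funext => i; apply/funext => j; rewrite /sscale /smul mulr_fsumr.
by apply: eq_fsbigr => k _; rewrite mulrA.
Qed.

End finite_rows.

(** * The block shift as translation of exponents *)

Section shift.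
Context {C : numClosedFieldType}.
Implicit Types I J : Type.

(** Inverse of [Zexp]: [Negz N] stands for [-(N+1)], the exponent of block [2N+1]. *)
Definition Zidx (k : int) : nat :=
  match k with Posz N => N.*2 | Negz N => N.*2.+1 end.

Lemma ZidxK : cancel Zidx Zexp.
Proof.
case=> N; rewrite /Zexp /= odd_double; first by rewrite doubleK.
by rewrite uphalf_double NegzE.
Qed.

Lemma ZexpK : cancel Zexp Zidx.
Proof.
move=> b; rewrite -[in RHS](odd_double_half b) /Zexp.
by case: (odd b); rewrite -?NegzE.
Qed.

(** In terms of exponents the three cases are one rule: even blocks step from [k] to [k+1], the
    entry [(1,0)] steps from [-1] to [0], and odd blocks step from [-(k+2)] to [-(k+1)]. *)
Lemma Upsilon_blockE a b : Upsilon_block a b = (Zexp b == Zexp a + 1).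
Proof.
rewrite /Upsilon_block /Zexp.
have := odd_double_half a; have := odd_double_half b.
by case: (odd a); case: (odd b) => /=; lia.
Qed.

(* Multiplication by [z ^ d] sends row [n] of [Z_[r](z)] to row [shift r d n]. *)
Definition shift r (d : int) n := (Zidx (Zexp (n %/ r) + d) * r + n %% r)%N.

Lemma Upsilon_shift r n m : (0 < r)%N ->
  Upsilon (C := C) r n m = (m == shift r 1 n)%:R.
Proof.
move=> r0; rewrite /Upsilon Upsilon_blockE; congr (nat_of_bool _)%:R.
apply/andP/eqP => [[/eqP e /eqP nm]|->].
  by rewrite /shift -e ZexpK nm -divn_eq.
rewrite /shift divnMDl// modnMDl modn_mod (divn_small (ltn_pmod _ _))// addn0.
by rewrite ZidxK eqxx.
Qed.

(** The same rule solved for the row index: with [Upsilon_shift] it leaves one nonzero entry in each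
    row and column, hence both finiteness conditions. *)
Lemma Upsilon_shiftN r n m : (0 < r)%N ->
  Upsilon (C := C) r n m = (n == shift r (-1) m)%:R.
Proof.
move=> r0; rewrite /Upsilon Upsilon_blockE; congr (nat_of_bool _)%:R.
apply/andP/eqP => [[/eqP e /eqP nm]|->].
  by rewrite /shift e addrK ZexpK -nm -divn_eq.
rewrite /shift divnMDl// modnMDl modn_mod (divn_small (ltn_pmod _ _))// addn0.
by rewrite ZidxK subrK eqxx.
Qed.

Lemma row_finite_delta (f : nat -> nat) (A : nat -> nat -> C) :
  (forall i k, A i k = (k == f i)%:R) -> row_finite A.
Proof. by move=> hA i; exists (f i).+1 => k; rewrite hA => /gtn_eqF->. Qed.

Lemma row_finite_Upsilon r : (0 < r)%N -> row_finite (Upsilon (C := C) r).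
Proof.
move=> r0; apply: (row_finite_delta (f := shift r 1)) => i k.
exact: Upsilon_shift.
Qed.

Lemma column_finite_Upsilon r : (0 < r)%N -> column_finite (Upsilon (C := C) r).
Proof.
move=> r0; apply: (row_finite_delta (f := shift r (-1))) => i k.
exact: Upsilon_shiftN.
Qed.

Lemma Upsilon_smul r J (X : nat -> J -> C) n j : (0 < r)%N ->
  (Upsilon r ** X) n j = X (shift r 1 n) j.
Proof. by move=> r0; apply: smul_delta => k; exact: Upsilon_shift. Qed.

Lemma strans_Upsilon_smul r J (X : nat -> J -> C) n j : (0 < r)%N ->
  (strans (Upsilon r) ** X) n j = X (shift r (-1) n) j.
Proof. by move=> r0; apply: smul_delta => k; exact: Upsilon_shiftN. Qed.

Lemma smul_Upsilon r I (X : I -> nat -> C) i m : (0 < r)%N ->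
  (X ** Upsilon r) i m = X i (shift r (-1) m).
Proof.
move=> r0; rewrite -[LHS]/(strans (X ** Upsilon r) m i) strans_smul.
exact: strans_Upsilon_smul.
Qed.

Lemma smul_strans_Upsilon r I (X : I -> nat -> C) i m : (0 < r)%N ->
  (X ** strans (Upsilon r)) i m = X i (shift r 1 m).
Proof.
move=> r0; rewrite -[LHS]/(strans (X ** strans (Upsilon r)) m i) strans_smul.
exact: Upsilon_smul.
Qed.

(** * Evaluation of Laurent polynomials with matrix coefficients *)

Lemma fsumT_seq (K : choiceType) (s : seq K) (F : K -> C) :
  uniq s -> (forall k, k \notin s -> F k = 0) ->
  \sum_(k \in [set: K]) F k = \sum_(k <- s) F k.
Proof.
move=> us F0; rewrite (fsbigE s)//; last by move=> k _; exact: F0.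
by apply: eq_bigl => k; rewrite in_setT.
Qed.

Lemma leval_Zmx r z n (j : 'I_r) :
  leval (Zmx r) z n j = (n %% r == j)%N%:R * z ^ Zexp (n %/ r) :> C.
Proof.
rewrite /leval (@fsumT_seq _ [:: Zexp (n %/ r)])//.
  by rewrite big_seq1 /Zmx eqxx.
by move=> k; rewrite inE /Zmx => /negPf->; rewrite mul0r.
Qed.

Lemma leval_ltrans I J (P : laurent (C := C) I J) z :
  leval (ltrans P) z = strans (leval P z).
Proof. by []. Qed.

(** A row of [A] meets finitely many rows of [Zmx], so the sums over exponents and over rows are
    both finite and can be exchanged. *)
Lemma leval_lmull r I (A : I -> nat -> C) z : row_finite A ->
  leval (lmull A (Zmx r)) z = A ** leval (Zmx r) z.
Proof.
move=> hA; apply/funext => i; apply/funext => j; have [N hN] := hA i.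
rewrite (@smulE _ N) => [|l /hN->]; last by rewrite mul0r.
(* Exponents of the first [N] rows; the [r] rows of a block share one exponent, so repetitions are
   removed. *)
pose s := undup [seq Zexp (l %/ r) | l <- iota 0 N].
have ls l : (l < N)%N -> Zexp (l %/ r) \in s.
  move=> lN; rewrite mem_undup; apply: (map_f (fun l => Zexp (l %/ r))).
  by rewrite mem_iota add0n.
have Z0 k l : (l < N)%N -> k \notin s -> Zmx r k l j = 0 :> C.
  by move=> /ls ks; rewrite /Zmx; case: eqVneq => // ->; rewrite ks.
have E k : lmull A (Zmx r) k i j = \sum_(l < N) A i l * Zmx r k l j.
  by apply: smulE => l /hN->; rewrite mul0r.
rewrite /leval (@fsumT_seq _ s) ?undup_uniq// => [|k ks]; last first.
  by rewrite E big1 ?mul0r// => l _; rewrite Z0 ?mulr0.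
under eq_bigr do rewrite E mulr_suml.
rewrite exchange_big; apply: eq_bigr => l _.
rewrite (@fsumT_seq _ s) ?undup_uniq// => [|k ks]; last by rewrite Z0 ?mul0r.
by rewrite mulr_sumr; apply: eq_bigr => k _; rewrite mulrA.
Qed.

Lemma lmulr_ltrans r J (V : nat -> J -> C) :
  lmulr (ltrans (Zmx r)) V = ltrans (lmull (strans V) (Zmx r)).
Proof. by apply/funext => k; rewrite /ltrans /lmull strans_smul. Qed.

Lemma leval_lmulr r J (V : nat -> J -> C) z : column_finite V ->
  leval (lmulr (ltrans (Zmx r)) V) z = strans (leval (Zmx r) z) ** V.
Proof.
by move=> hV; rewrite lmulr_ltrans leval_ltrans leval_lmull// strans_smul.
Qed.

(** The coefficients of [Zmx] are 0 or 1, hence fixed by conjugation. *)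
Lemma lconj_lmull r I (A : I -> nat -> C) : row_finite A ->
  lconj (lmull A (Zmx r)) = lmull (sconj A) (Zmx r).
Proof.
move=> hA; apply/funext => k; rewrite /lconj /lmull sconj_smul//.
congr (_ ** _); apply/funext => n; apply/funext => j.
by rewrite /sconj /Zmx rmorph_nat.
Qed.

Lemma lconj_lmulr r J (V : nat -> J -> C) : column_finite V ->
  lconj (lmulr (ltrans (Zmx r)) V) = lmulr (ltrans (Zmx r)) (sconj V).
Proof.
move=> hV; rewrite !lmulr_ltrans.
by rewrite -[LHS]/(ltrans (lconj (lmull (strans V) (Zmx r)))) lconj_lmull.
Qed.

(** The exponent of the block grows by [d] while the position inside the block is kept; [z != 0]
    makes integer powers additive. *)
Lemma leval_Zmx_shift r d z n (j : 'I_r) : z != 0 ->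
  leval (Zmx r) z (shift r d n) j = z ^ d * leval (Zmx r) z n j :> C.
Proof.
move=> z0; have r0 : (0 < r)%N by apply: leq_ltn_trans (ltn_ord j).
rewrite !leval_Zmx /shift divnMDl// modnMDl modn_mod.
rewrite (divn_small (ltn_pmod _ _))// addn0 ZidxK.
by rewrite addrC expfzDr// mulrCA.
Qed.

Lemma leval_ltrans_Zmx_shift r d z n (j : 'I_r) : z != 0 ->
  leval (ltrans (Zmx r)) z j (shift r d n) =
  z ^ d * leval (ltrans (Zmx r)) z j n :> C.
Proof. exact: leval_Zmx_shift. Qed.

(** First of four eigenvector relations, one per recurrence. Where the permutation shifts by [-1],
    the evaluation point is [z^-1], and the factor is again [z]. *)
Lemma Upsilon_Zmx r z : (0 < r)%N -> z != 0 ->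
  Upsilon r ** leval (Zmx r) z = sscale z (leval (Zmx r) z) :> (_ -> _ -> C).
Proof.
move=> r0 z0; apply/funext => n; apply/funext => j.
by rewrite Upsilon_smul// leval_Zmx_shift// expr1z.
Qed.

Lemma strans_Upsilon_Zmx r z : (0 < r)%N -> z != 0 ->
  strans (Upsilon r) ** leval (Zmx r) z^-1 =
  sscale z (leval (Zmx r) z^-1) :> (_ -> _ -> C).
Proof.
move=> r0 z0; apply/funext => n; apply/funext => j.
by rewrite strans_Upsilon_smul// leval_Zmx_shift ?invr_eq0// exprN1 invrK.
Qed.

Lemma Zmx_Upsilon r z : (0 < r)%N -> z != 0 ->
  strans (leval (Zmx r) z^-1) ** Upsilon r =
  sscale z (strans (leval (Zmx r) z^-1)) :> (_ -> _ -> C).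
Proof.
move=> r0 z0; apply/funext => j; apply/funext => n.
by rewrite smul_Upsilon// /strans leval_Zmx_shift ?invr_eq0// exprN1 invrK.
Qed.

Lemma Zmx_strans_Upsilon r z : (0 < r)%N -> z != 0 ->
  strans (leval (Zmx r) z) ** strans (Upsilon r) =
  sscale z (strans (leval (Zmx r) z)) :> (_ -> _ -> C).
Proof.
move=> r0 z0; apply/funext => j; apply/funext => n.
by rewrite smul_strans_Upsilon// /strans leval_Zmx_shift// expr1z.
Qed.

End shift.

(** * Shift symmetry of the moment matrices *)

Section moments.
Context {R : realType} {p q : nat}.
Variable mu : 'M[complexMeasure R]_(q, p).
Hypotheses (p_gt0 : (0 < p)%N) (q_gt0 : (0 < q)%N).

Lemma circle_val_neq0 (z : borelCircle R) : circle_val z != 0.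
Proof.
have : circle_val z \in circle R by exact: valP.
by rewrite inE /circle /= -normr_eq0 => ->; rewrite oner_eq0.
Qed.

(** The integrands agree pointwise on the circle: one shift contributes [z ^ d], the other
    [(z^-1) ^ (- d)]. *)
Lemma left_moment_shift d n m :
  left_moment mu (shift q d n) m = left_moment mu n (shift p (- d) m).
Proof.
rewrite /left_moment /oint_mx; apply: eq_bigr => i _; apply: eq_bigr => j _.
congr complex_integral; apply/funext => z; have z0 := circle_val_neq0 z.
rewrite leval_Zmx_shift ?leval_ltrans_Zmx_shift ?invr_eq0//.
by rewrite exprz_inv opprK mulrCA mulrA.
Qed.

Lemma right_moment_shift d n m :
  right_moment mu (shift q d n) m = right_moment mu n (shift p (- d) m).
Proof.
rewrite /right_moment /oint_mx; apply: eq_bigr => i _; apply: eq_bigr => j _.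
congr complex_integral; apply/funext => z; have z0 := circle_val_neq0 z.
rewrite leval_Zmx_shift ?leval_ltrans_Zmx_shift ?invr_eq0//.
by rewrite exprz_inv mulrCA mulrA.
Qed.

Lemma left_moment_Upsilon :
  Upsilon q ** left_moment mu = left_moment mu ** Upsilon p.
Proof.
apply/funext => n; apply/funext => m.
rewrite (Upsilon_smul _ _ _ q_gt0) (smul_Upsilon _ _ _ p_gt0).
exact: left_moment_shift.
Qed.

Lemma right_moment_Upsilon :
  strans (Upsilon q) ** right_moment mu = right_moment mu ** strans (Upsilon p).
Proof.
apply/funext => n; apply/funext => m.
rewrite (strans_Upsilon_smul _ _ _ q_gt0) (smul_strans_Upsilon _ _ _ p_gt0).
by rewrite right_moment_shift opprK.
Qed.

End moments.

(** * The four recurrences *)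

Theorem proposition2p25 (R : realType) (p q : nat) (hp : (0 < p)%N)
    (hq : (0 < q)%N) (mu : 'M[complexMeasure R]_(q, p))
    (hmu : forall i j, infinite_set (measure_support (mu i j)))
    (L U cL cU T cT : nat -> nat -> R[i])
    (hL : lower_triangular L) (hL0 : nonzero_diagonal L)
    (hU : upper_triangular U) (hU0 : nonzero_diagonal U)
    (hcL : lower_triangular cL) (hcL0 : nonzero_diagonal cL)
    (hcU : upper_triangular cU) (hcU0 : nonzero_diagonal cU)
    (hM : left_moment mu = sinv L ** sinv (sconj U))
    (hcM : right_moment mu = sinv (sconj cL) ** sinv cU)
    (hT : T = L ** Upsilon q ** sinv L)
    (hcT : cT = sconj cL ** strans (Upsilon q) ** sinv (sconj cL)) :
  let B := lmull L (Zmx q) in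
  let A := lmulr (ltrans (Zmx p)) U in
  let cA := lmull cL (Zmx q) in
  let cB := lmulr (ltrans (Zmx p)) cU in
  forall z : R[i], z != 0 ->
    [/\ T ** leval B z = sscale z (leval B z),
        leval (lconj A) z^-1 ** T = sscale z (leval (lconj A) z^-1),
        cT ** leval (lconj cA) z^-1 = sscale z (leval (lconj cA) z^-1) &
        leval cB z ** cT = sscale z (leval cB z)].
Proof.
move=> B A cA cB z z0.
have scL := lower_sconj hcL; have scL0 := nonzero_diagonal_sconj hcL0.
have sU := upper_sconj hU; have sU0 := nonzero_diagonal_sconj hU0.
have SM := left_moment_Upsilon mu hp hq; rewrite hM in SM.
have ScM := right_moment_Upsilon mu hp hq; rewrite hcM in ScM.
have rq := row_finite_Upsilon (C := R[i]) hq.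
have cp := column_finite_Upsilon (C := R[i]) hp.
have rTq : row_finite (strans (Upsilon (C := R[i]) q)) by exact: column_finite_Upsilon.
have cTp : column_finite (strans (Upsilon (C := R[i]) p)) by exact: row_finite_Upsilon.
rewrite hT hcT /B /A /cA /cB; split.
- rewrite leval_lmull; last exact: row_finite_lower.
  exact/lower_recurrence/Upsilon_Zmx.
(* Conjugation turns [U] into [sconj U], the matrix whose inverse is the upper factor of
   [left_moment mu]. *)
- rewrite lconj_lmulr ?leval_lmulr; try exact: column_finite_upper.
  exact/(upper_recurrence hL hL0 sU sU0 rq cp SM)/Zmx_Upsilon.
(* Conjugation turns [cL] into [sconj cL], the matrix that conjugates the transposed shift in
   [cT]. *)
- rewrite lconj_lmull ?leval_lmull; try exact: row_finite_lower.
  exact/lower_recurrence/strans_Upsilon_Zmx.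
- rewrite leval_lmulr; last exact: column_finite_upper.
  exact/(upper_recurrence scL scL0 hcU hcU0 rTq cTp ScM)/Zmx_strans_Upsilon.
Qed.
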